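(* Let $E$ be a measure which is a type I and a type II entanglement monotone and which is non-increasing under coarsening. Then $E(\Psi)=E^*$ for every encoded universal resource $\Psi$. In particular, $E_s(\Psi)=E_g(\Psi)=\infty$ for every encoded universal resource $\Psi$.
   Context: Write $|\psi\rangle\geq_{\mathrm{LOCC}}|\phi\rangle$ (for $N$-qubit $|\psi\rangle$, $n$-qubit $|\phi\rangle$, $n\le N$) if for some set $A$ of $n$ qubits $|\psi\rangle\to|\phi\rangle^A|0\rangle^{\bar A}$ is achievable exactly with probability one by LOCC (each physical qubit a party). Type I monotone: $M(|\psi\rangle)\ge\sum_ip_iM(|\psi_i\rangle)$ whenever an LOCC protocol maps $|\psi\rangle$ to $|\psi_i\rangle$ with probabilities $p_i$. Type II monotone: $E(|\psi\rangle)\ge E(|\psi'\rangle)$ whenever $|\psi\rangle\geq_{\mathrm{LOCC}}|\psi'\rangle$. For a state $|\psi\rangle$ on a qubit set $S$ and a partition $\mathcal P$ of $S$, $E^{\mathcal P}$ denotes the same measure defined with the blocks of $\mathcal P$ regarded as the parties; $E$ is non-increasing under coarsening if $E^{\mathcal P}(|\psi\rangle)\le E(|\psi\rangle)$ for all $|\psi\rangle$ and $\mathcal P$. $E^*=\sup E$ over all multi-qubit states, $E(\Psi)=\sup_{|\psi\rangle\in\Psi}E(|\psi\rangle)$. Encodings: an $m$-qubit encoding of an $n$-qubit system is a set $E$ of $mn$ qubits, a partition into $n$ blocks $A_1,\dots,A_n$ of $m$ qubits, and orthogonal $m$-qubit states $|\mathbf0\rangle,|\mathbf1\rangle$; $|\phi\rangle=\sum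 c_{i_1\dots i_n}|i_1\dots i_n\rangle$ is encoded as $\sum c_{i_1\dots i_n}|\mathbf i_1\rangle_{A_1}\cdots|\mathbf i_n\rangle_{A_n}$. Given qubit sets $E_1\subseteq E_2\subseteq\cdots$ and states $|\psi_i\rangle$ on $E_i$, a consistent family of encodings assigns to each $E_i$ an $m$-qubit encoding (fixed $m$, $|\mathbf0\rangle$, $|\mathbf1\rangle$) with block partitions $\mathcal P_i\subseteq\mathcal P_{i+1}$. $\Psi=\{|\psi_i\rangle\}$ is an encoded universal resource if for some consistent family of encodings, for every $n$ and every $n$-qubit $|\phi\rangle$ there is $i$ with $|\psi_i\rangle\geq_{\mathrm{LOCC}}|\boldsymbol\phi\rangle$, where $|\boldsymbol\phi\rangle$ is the encoded version of $|\phi\rangle$ on $n$ blocks of $\mathcal P_i$. $E_g(|\psi\rangle)=-\log_2\max|\langle\psi|\varphi_1\otimes\cdots\otimes\varphi_N\rangle|^2$ over product states; $E_s(|\psi\rangle)=\log_2K$ with $K$ the minimal number of product states whose span contains $|\psi\rangle$. *)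

(* Defs.v *)
(* mathcomp + mathcomp-analysis (reals, extended reals, ln)
   + real-closed (complex numbers R[i]). *)
From mathcomp Require Import all_boot all_order all_algebra.
From mathcomp Require Import boolp classical_sets reals ereal exp.
From mathcomp Require Import complex.
From mathcomp Require Import finset.
Set Implicit Arguments.
Unset Strict Implicit.
Unset Printing Implicit Defensive.
Import Order.TTheory GRing.Theory Num.Theory.
Local Open Scope ring_scope.

Section QuantumDefs.
Variable R : realType.
Local Notation C := (R[i]).

(* Multi-qubit pure states.  A finite set of physical qubits is a      *)
(* finType Q; computational basis states are the x : {ffun Q -> bool}; *)
(* a (not necessarily normalized) vector is an amplitude function.     *)
Definition basis (Q : finType) := {ffun Q -> bool}.
Definition qstate (Q : finType) := {ffun basis Q -> C}.

(* squared modulus of a complex number *)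
Definition sqmod (z : C) : R := complex.Re z ^+ 2 + complex.Im z ^+ 2.

(* inner product <psi|phi> (antilinear in the first argument) *)
Definition inner (Q : finType) (psi phi : qstate Q) : C :=
  \sum_(x : basis Q) ((psi x)^*)%C * phi x.

(* squared norm ||psi||^2 *)
Definition norm2 (Q : finType) (psi : qstate Q) : R :=
  \sum_(x : basis Q) sqmod (psi x).

Definition normalized (Q : finType) (psi : qstate Q) : Prop := norm2 psi = 1.

Definition scalev (Q : finType) (c : C) (psi : qstate Q) : qstate Q :=
  [ffun x => c * psi x].

(* psi / ||psi|| *)
Definition normalize (Q : finType) (psi : qstate Q) : qstate Q :=
  scalev (((Num.sqrt (norm2 psi))^-1)%:C)%C psi.

(* the finest partition: every qubit is its own party *)
Definition finest (Q : finType) : {set {set Q}} := [set [set q] | q : Q].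

(* Operators acting locally on a set B of qubits.  A local operator is *)
(* given by its matrix u on the qubits of B: u x y is only used for x, *)
(* y vanishing outside B (through restrB).                             *)
Definition restrB (Q : finType) (B : {set Q}) (x : basis Q) : basis Q :=
  [ffun q => (q \in B) && x q].

Definition locmat (Q : finType) := basis Q -> basis Q -> C.

(* full matrix of the operator u acting on B (identity elsewhere) *)
Definition opmat (Q : finType) (B : {set Q}) (u : locmat Q) (x y : basis Q) : C :=
  if [forall q, (q \notin B) ==> (x q == y q)] then u (restrB B x) (restrB B y)
  else 0.

Definition applyop (Q : finType) (B : {set Q}) (u : locmat Q) (psi : qstate Q)
  : qstate Q :=
  [ffun x => \sum_(y : basis Q) opmat B u x y * psi y].

(* a family of Kraus operators on B forming a complete instrument:
   sum_k K_k^dagger K_k = identity *)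
Definition complete_kraus (Q : finType) (B : {set Q}) (n : nat)
  (K : 'I_n -> locmat Q) : Prop :=
  forall x y : basis Q,
    \sum_(k < n) \sum_(z : basis Q) ((opmat B (K k) z x)^*)%C * opmat B (K k) z y
    = (x == y)%:R.

(* a unitary acting on the qubits of B *)
Definition local_unitary (Q : finType) (B : {set Q}) (u : locmat Q) : Prop :=
  complete_kraus B (fun _ : 'I_1 => u).

(* LOCC protocols (each physical qubit a party): finite trees; at each *)
(* node one qubit-party performs a local instrument (Kraus operators)  *)
(* and the subsequent protocol may depend on the (communicated)        *)
(* outcome.                                                            *)
Inductive protocol (Q : finType) : Type :=
| Leaf : protocol Q
| Meas : forall (q : Q) (n : nat), ('I_n -> locmat Q) ->
           ('I_n -> protocol Q) -> protocol Q.

Fixpoint valid_protocol (Q : finType) (p : protocol Q) : Prop :=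
  match p with
  | Leaf => True
  | Meas q n K next =>
      complete_kraus [set q] K /\ forall k, valid_protocol (next k)
  end.

(* the unnormalized branch vectors produced by the protocol; a branch
   vector v occurs with probability norm2 v and leaves the normalized
   state normalize v *)
Fixpoint outcomes (Q : finType) (p : protocol Q) (psi : qstate Q)
  : seq (qstate Q) :=
  match p with
  | Leaf => [:: psi]
  | Meas q n K next =>
      flatten [seq outcomes (next k) (applyop [set q] (K k) psi) | k <- enum 'I_n]
  end.

(* psi -> phi exactly with probability one by LOCC (up to global phase) *)
Definition locc_exact (Q : finType) (psi phi : qstate Q) : Prop :=
  exists p : protocol Q, valid_protocol p /\
    forall v, v \in outcomes p psi -> exists c : C, v = scalev c phi.

(* |phi>^A |0>^{Q \ A}, where A is the image of the injection a *)
Definition embed (Q' Q : finType) (a : Q' -> Q) (phi : qstate Q') : qstate Q :=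
  [ffun x : basis Q =>
     if [forall q, (q \notin codom a) ==> ~~ x q]
     then phi [ffun q' => x (a q')] else 0].

(* psi >=_LOCC phi *)
Definition geLOCC (Q Q' : finType) (psi : qstate Q) (phi : qstate Q') : Prop :=
  exists a : Q' -> Q, injective a /\ locc_exact psi (embed a phi).

(* Entanglement measures.  A measure is given together with its        *)
(* versions E^P for all party structures P (partitions of the qubits): *)
(* E Q P psi is the value of the measure on psi when the blocks of P   *)
(* are the parties.  E(psi) is the value for qubit parties.            *)
Definition emeasure := forall Q : finType, {set {set Q}} -> qstate Q -> \bar R.

Definition Eq (E : emeasure) (Q : finType) (psi : qstate Q) : \bar R :=
  E Q (finest Q) psi.

(* relabel qubits along f : Q -> Q' *)
Definition relabel (Q Q' : finType) (f : Q -> Q') (psi : qstate Q) : qstate Q' :=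
  [ffun x' : basis Q' => psi [ffun q => x' (f q)]].

(* add ancilla qubits Q0 in state |0> *)
Definition append0 (Q Q0 : finType) (psi : qstate Q) : qstate (Q + Q0)%type :=
  [ffun x : basis (Q + Q0)%type =>
     if [forall a : Q0, ~~ x (inr a)] then psi [ffun q => x (inl q)] else 0].

(* "E^P is the same measure with the blocks of P regarded as parties":
   E^P depends on the multipartite state only up to local isometries of
   the parties, i.e. it is invariant under relabelling of qubits (and of
   parties), under adjoining ancilla qubits in |0> to parties, and under
   unitaries acting locally on a single party. *)
Definition measure_consistent (E : emeasure) : Prop :=
  [/\ (forall (Q Q' : finType) (f : Q -> Q') (P : {set {set Q}}) (psi : qstate Q),
         bijective f -> partition P [set: Q] -> normalized psi ->
         E Q' (@imset _ _ (fun B : {set Q} => f @: B) (mem P)) (relabel f psi) = E Q P psi),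
      (forall (Q Q0 : finType) (g : Q0 -> Q) (P : {set {set Q}}) (psi : qstate Q),
         partition P [set: Q] -> normalized psi ->
         E (Q + Q0)%type
           (@imset _ _ (fun B : {set Q} =>
              (@inl Q Q0 @: B) :|: (@inr Q Q0 @: (g @^-1: B))) (mem P))
           (append0 Q0 psi) = E Q P psi)
    & (forall (Q : finType) (P : {set {set Q}}) (B : {set Q}) (u : locmat Q)
          (psi : qstate Q),
         partition P [set: Q] -> B \in P -> local_unitary B u -> normalized psi ->
         E Q P (applyop B u psi) = E Q P psi)].

Local Open Scope ereal_scope.

(* type I monotone (non-increasing on average under LOCC) *)
Definition typeI (E : emeasure) : Prop :=
  forall (Q : finType) (p : protocol Q) (psi : qstate Q),
    valid_protocol p -> normalized psi ->
    \sum_(v <- outcomes p psi | norm2 v != 0%R) ((norm2 v)%:E * Eq E (normalize v))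
      <= Eq E psi.

(* type II monotone *)
Definition typeII (E : emeasure) : Prop :=
  forall (Q Q' : finType) (psi : qstate Q) (phi : qstate Q'),
    normalized psi -> normalized phi -> geLOCC psi phi -> Eq E phi <= Eq E psi.

(* non-increasing under coarsening *)
Definition coarsening_nonincreasing (E : emeasure) : Prop :=
  forall (Q : finType) (P : {set {set Q}}) (psi : qstate Q),
    partition P [set: Q] -> normalized psi -> E Q P psi <= Eq E psi.

(* E^* = sup of E over all multi-qubit states *)
Definition Estar (F : forall Q : finType, qstate Q -> \bar R) : \bar R :=
  ereal_sup (fun e : \bar R => exists (Q : finType) (psi : qstate Q),
                       normalized psi /\ e = F Q psi).

Local Close Scope ereal_scope.

(* Encodings and encoded universal resources.                          *)
(* Qubit sets E_0 ⊆ E_1 ⊆ ... are finTypes Es i with injective         *)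
(* inclusions incl i : Es i -> Es i.+1.                                 *)
(* An m-qubit encoding of E_i with n_i blocks is a bijection            *)
(* emb i : 'I_(n_i) * 'I_m -> Es i (emb i (j, k) = k-th qubit of block  *)
(* j); the block partition is P_i = {emb i ({j} x 'I_m) | j}.           *)
Definition block (Q : finType) (n m : nat) (emb : 'I_n * 'I_m -> Q) (j : 'I_n)
  : {set Q} := [set emb (j, k) | k : 'I_m].

(* encoded version of the n-qubit state phi with logical states zero,one *)
Definition encode (n m : nat) (zero one : qstate 'I_m) (phi : qstate 'I_n)
  : qstate ('I_n * 'I_m)%type :=
  [ffun x : basis ('I_n * 'I_m)%type =>
     \sum_(c : basis 'I_n)
        phi c * \prod_(j < n)
           (if c j then one [ffun k => x (j, k)] else zero [ffun k => x (j, k)])].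

Definition encoded_universal_resource (Es : nat -> finType)
  (incl : forall i, Es i -> Es i.+1) (psi : forall i, qstate (Es i)) : Prop :=
  exists (m : nat) (zero one : qstate 'I_m) (nb : nat -> nat)
         (emb : forall i, 'I_(nb i) * 'I_m -> Es i),
    [/\ [/\ normalized zero, normalized one & inner zero one = 0],
        (forall i, bijective (emb i)),
        (* consistency: P_i ⊆ P_{i+1} *)
        (forall i (j : 'I_(nb i)), exists j' : 'I_(nb i.+1),
            incl i @: block (emb i) j = block (emb i.+1) j')
      & (* universality *)
        forall (n : nat) (phi : qstate 'I_n), normalized phi ->
          exists i (b : 'I_n -> 'I_(nb i)), injective b /\
            locc_exact (psi i)
              (embed (fun jk : 'I_n * 'I_m => emb i (b jk.1, jk.2))
                     (encode zero one phi))].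

(* Schmidt measure and geometric measure (qubit parties).              *)
Definition log2 (x : R) : R := ln x / ln 2.

(* a (possibly unnormalized) product vector *)
Definition product_vec (Q : finType) (phi : qstate Q) : Prop :=
  exists v : Q -> bool -> C, forall x : basis Q, phi x = \prod_(q : Q) v q (x q).

(* a normalized product state phi_1 ⊗ ... ⊗ phi_N *)
Definition product_state (Q : finType) (phi : qstate Q) : Prop :=
  exists v : Q -> bool -> C,
    (forall q, sqmod (v q false) + sqmod (v q true) = 1) /\
    forall x : basis Q, phi x = \prod_(q : Q) v q (x q).

Definition E_g (Q : finType) (psi : qstate Q) : \bar R :=
  (- log2 (sup (fun r : R => exists phi : qstate Q,
                   product_state phi /\ r = sqmod (inner psi phi))))%:E.

(* log2 K, K the minimal number of product states whose span contains psi *)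
Definition E_s (Q : finType) (psi : qstate Q) : \bar R :=
  ereal_inf (fun e : \bar R => exists k : nat,
     e = (log2 k%:R)%:E /\
     exists phis : 'I_k -> qstate Q,
        (forall j, product_vec (phis j)) /\
        psi = [ffun x => \sum_(j < k) phis j x]).

(* value of a state measure on a family of states: sup over the family *)
Definition Efam (F : forall Q : finType, qstate Q -> \bar R) (Es : nat -> finType)
  (psi : forall i, qstate (Es i)) : \bar R :=
  ereal_sup (fun e : \bar R => exists i : nat, e = F (Es i) (psi i)).

End QuantumDefs.

(* Main.v *)
Require Import Defs.
From mathcomp Require Import all_boot all_order all_algebra.
From mathcomp Require Import boolp classical_sets reals ereal exp.
From mathcomp Require Import complex.
From mathcomp Require Import ring lra.
From mathcomp Require Import finset.

(** The encoded state is reached from the resource, so by type II monotonicity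
    and coarsening to the encoding blocks, [E] of the resource dominates the
    block measure of the encoded state.  The latter is [E] of the logical
    state: adjoin ancillas in |0> to each logical qubit and rotate each block
    by a product of two reflections carrying |00...0>, |10...0> to the logical
    basis states.

    For [E_s] and [E_g] the logical state is a collection of [k] Bell pairs.
    Local operations map product vectors to product vectors, so neither the
    number of product terms grows nor does the maximal product overlap shrink
    in a deterministic LOCC conversion; the adjoint of the encoding also
    preserves product vectors and is a contraction.  Bell pairs need [2 ^ k]
    product terms (rank of the identity matrix) and have squared overlap at
    most [2 ^ -k] with product states. *)

Set Implicit Arguments.
Unset Strict Implicit.
Unset Printing Implicit Defensive.
Import Order.TTheory GRing.Theory Num.Theory.
Local Open Scope ring_scope.
Local Notation basis := Defs.basis.

(** * Squared moduli and inner products of amplitude vectors *)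

Section ComplexAmplitudes.
Variable R : realType.
Local Notation C := (R[i]).

Lemma conjc_sum (I : Type) (r : seq I) (P : pred I) (F : I -> C) :
  ((\sum_(i <- r | P i) F i)^*)%C = \sum_(i <- r | P i) ((F i)^*)%C.
Proof. exact: (rmorph_sum (@conjc R)). Qed.

Lemma conjc_prod (I : Type) (r : seq I) (P : pred I) (F : I -> C) :
  ((\prod_(i <- r | P i) F i)^*)%C = \prod_(i <- r | P i) ((F i)^*)%C.
Proof. exact: (rmorph_prod (@conjc R)). Qed.

Lemma conjcM (x y : C) : ((x * y)^*)%C = (x^*)%C * (y^*)%C.
Proof. exact: (rmorphM (@conjc R)). Qed.

Lemma conjcD (x y : C) : ((x + y)^*)%C = (x^*)%C + (y^*)%C.
Proof. exact: (rmorphD (@conjc R)). Qed.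

Lemma conjcB (x y : C) : ((x - y)^*)%C = (x^*)%C - (y^*)%C.
Proof. exact: (rmorphB (@conjc R)). Qed.

Lemma ReD (x y : C) : complex.Re (x + y) = complex.Re x + complex.Re y.
Proof. by case: x; case: y. Qed.

Lemma Re_sum (I : Type) (r : seq I) (P : pred I) (F : I -> C) :
  complex.Re (\sum_(i <- r | P i) F i) = \sum_(i <- r | P i) complex.Re (F i).
Proof. exact: (big_morph _ ReD (erefl _)). Qed.

Lemma sqmod_ge0 (z : C) : 0 <= sqmod z.
Proof. by rewrite addr_ge0 ?sqr_ge0. Qed.

Lemma sqmodE (z : C) : ((sqmod z)%:C)%C = (z^*)%C * z.
Proof.
by case: z => a b; apply/eqP; rewrite eq_complex /sqmod /= ; apply/andP; split;
  apply/eqP; ring.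
Qed.

Lemma sqmodM (x y : C) : sqmod (x * y) = sqmod x * sqmod y.
Proof. by case: x => a b; case: y => c d; rewrite /sqmod /=; ring. Qed.

Lemma sqmod_conj (x : C) : sqmod (x^*)%C = sqmod x.
Proof. by case: x => a b; rewrite /sqmod /= sqrrN. Qed.

Lemma sqmod0 : sqmod (0 : C) = 0.
Proof. by rewrite /sqmod /= expr0n addr0. Qed.

Lemma sqmod1 : sqmod (1 : C) = 1.
Proof. by rewrite /sqmod /= expr0n expr1n addr0. Qed.

Lemma sqmod_real (a : R) : sqmod (a%:C)%C = a ^+ 2.
Proof. by rewrite /sqmod /= expr0n addr0. Qed.

Lemma sqmod_eq0 (z : C) : (sqmod z == 0) = (z == 0).
Proof.
by case: z => a b; rewrite /sqmod eq_complex /= paddr_eq0 ?sqr_ge0 // !sqrf_eq0.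
Qed.

Lemma sqmod_prod (I : Type) (r : seq I) (P : pred I) (F : I -> C) :
  sqmod (\prod_(i <- r | P i) F i) = \prod_(i <- r | P i) sqmod (F i).
Proof. exact: (big_morph _ sqmodM sqmod1). Qed.

(** Cauchy-Schwarz in dimension two; it bounds the overlap of one Bell pair with a product of two
    qubits. *)
Lemma sqmod_pair_le (a0 a1 b0 b1 : C) :
  sqmod (a0 * b0 + a1 * b1) <= (sqmod a0 + sqmod a1) * (sqmod b0 + sqmod b1).
Proof.
(* Lagrange's identity *)
have -> : (sqmod a0 + sqmod a1) * (sqmod b0 + sqmod b1) =
  sqmod (a0 * b0 + a1 * b1) + sqmod (a0 * (b1^*)%C - a1 * (b0^*)%C).
  by case: a0 => ? ?; case: a1 => ? ?; case: b0 => ? ?; case: b1 => ? ?;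
    rewrite /sqmod /=; ring.
by rewrite lerDl sqmod_ge0.
Qed.

Section Vectors.
Variable Q : finType.
Implicit Types (psi phi v w : qstate R Q).

Lemma norm2_ge0 psi : 0 <= norm2 psi.
Proof. by apply: sumr_ge0 => x _; exact: sqmod_ge0. Qed.

Lemma norm2_eq0 psi : norm2 psi = 0 -> forall x, psi x = 0.
Proof.
move=> /eqP; rewrite psumr_eq0; last by move=> x _; exact: sqmod_ge0.
by move=> /allP h x; apply/eqP; rewrite -sqmod_eq0; apply: h; rewrite mem_index_enum.
Qed.

Lemma norm2E psi : ((norm2 psi)%:C)%C = inner psi psi.
Proof.
rewrite /norm2 (rmorph_sum (real_complex R)) /=.
by apply: eq_bigr => x _; exact: sqmodE.
Qed.

Lemma norm2_Re psi : norm2 psi = complex.Re (inner psi psi).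
Proof. by rewrite -norm2E. Qed.

Lemma inner_conj psi phi : inner phi psi = ((inner psi phi)^*)%C.
Proof.
rewrite /inner conjc_sum; apply: eq_bigr => x _.
by rewrite conjcM conjcK mulrC.
Qed.

Lemma inner_scaler c psi phi : inner psi (scalev c phi) = c * inner psi phi.
Proof. by rewrite /inner mulr_sumr; apply: eq_bigr => x _; rewrite ffunE mulrCA. Qed.

Lemma inner_scalel c psi phi : inner (scalev c psi) phi = (c^*)%C * inner psi phi.
Proof. by rewrite inner_conj inner_scaler conjcM -inner_conj. Qed.

Lemma norm2_scale c psi : norm2 (scalev c psi) = sqmod c * norm2 psi.
Proof. by rewrite /norm2 mulr_sumr; apply: eq_bigr => x _; rewrite ffunE sqmodM. Qed.

Definition qadd psi phi : qstate R Q := [ffun x => psi x + phi x].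
Definition qopp psi : qstate R Q := [ffun x => - psi x].

Lemma inner_addr psi v w : inner psi (qadd v w) = inner psi v + inner psi w.
Proof. by rewrite /inner -big_split; apply: eq_bigr => x _; rewrite ffunE mulrDr. Qed.

Lemma inner_oppr psi v : inner psi (qopp v) = - inner psi v.
Proof. by rewrite /inner -sumrN; apply: eq_bigr => x _; rewrite ffunE mulrN. Qed.

Lemma inner_addl psi v w : inner (qadd v w) psi = inner v psi + inner w psi.
Proof. by rewrite inner_conj inner_addr conjcD -!inner_conj. Qed.

Lemma inner_oppl psi v : inner (qopp v) psi = - inner v psi.
Proof. by rewrite inner_conj inner_oppr (rmorphN (@conjc R)) /= -inner_conj. Qed.

Definition ket (c : basis Q) : qstate R Q := [ffun x => (x == c)%:R].

Lemma normalized_nz psi : normalized psi -> exists x, psi x != 0.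
Proof.
move=> n1; apply: contrapT => h.
have : norm2 psi = 0.
  apply: big1 => x _; apply/eqP; rewrite sqmod_eq0; apply/negPn/negP => hx.
  by apply: h; exists x.
by rewrite n1 => /eqP; rewrite oner_eq0.
Qed.

End Vectors.

(** * Summation over the bit strings that agree outside a set *)

Section Update.
Variables (J Q : finType) (e : J -> Q).
Hypothesis e_inj : injective e.

(** Injectivity of [e] makes the picked [j] unique. With [x] all false these are the strings
    supported on the image of [e], the only ones at which a local matrix is read. *)
Definition upd (x : basis Q) (s : basis J) : basis Q :=
  [ffun q => if [pick j | e j == q] is Some j then s j else x q].

Lemma upd_in x s j : upd x s (e j) = s j.
Proof.
rewrite ffunE; case: pickP => [j' /eqP/e_inj -> //|/(_ j)]; by rewrite eqxx.
Qed.

Lemma upd_out x s q : q \notin codom e -> upd x s q = x q.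
Proof.
move=> h; rewrite ffunE; case: pickP => // j /eqP ejq.
by move: h; rewrite -ejq codom_f.
Qed.

(** A string agreeing with [x] off [S] is determined by its bits on the image of [e], and these are
    free. *)
Lemma sum_upd (S : {set Q}) (V : zmodType) (x : basis Q) (F : basis Q -> V) :
  S =i codom e ->
  \sum_(y : basis Q | [forall q, (q \notin S) ==> (x q == y q)]) F y =
  \sum_(s : basis J) F (upd x s).
Proof.
move=> SE.
rewrite (reindex_onto (upd x) (fun y : basis Q => [ffun j => y (e j)])) /=; last first.
  move=> y /forallP h; apply/ffunP => q.
  have [/codomP [j ->]|qe] := boolP (q \in codom e); first by rewrite upd_in ffunE.
  by rewrite upd_out //; apply/eqP; have := h q; rewrite SE qe.
apply: eq_bigl => s; apply: (introT andP); split.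
  apply/forallP => q; apply/implyP; rewrite SE => h; by rewrite upd_out.
by apply/eqP/ffunP => j; rewrite ffunE upd_in.
Qed.

Lemma restrB_upd (S : {set Q}) x s : S =i codom e ->
  restrB S (upd x s) = upd [ffun => false] s.
Proof.
move=> SE; apply/ffunP => q; rewrite ffunE SE.
have [/codomP [j ->]|qe] := boolP (q \in codom e); first by rewrite !upd_in.
by rewrite /= upd_out ?ffunE.
Qed.

Lemma applyop_upd (S : {set Q}) u (psi : qstate R Q) x : S =i codom e ->
  applyop S u psi x =
  \sum_(s : basis J) u (restrB S x) (upd [ffun => false] s) * psi (upd x s).
Proof.
move=> SE; rewrite ffunE.
transitivity (\sum_(y : basis Q | [forall q, (q \notin S) ==> (x q == y q)])
   u (restrB S x) (restrB S y) * psi y).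
  rewrite [RHS]big_mkcond; apply: eq_bigr => y _.
  by rewrite /opmat; case: ifP => _ //; rewrite mul0r.
by rewrite (sum_upd _ _ SE); apply: eq_bigr => s _; rewrite restrB_upd.
Qed.

End Update.

(** * Product vectors under LOCC protocols *)

Section Locc.
Variable Q : finType.
Implicit Types (psi phi pi : qstate R Q).

(** The relation $\sum_k K_k^\dagger K_k = 1$ is inserted between [psi] and [phi]. For a single
    operator this is the invariance of inner products under a unitary. *)
Lemma kraus_inner (S : {set Q}) n (K : 'I_n -> locmat R Q) psi phi :
  complete_kraus S K ->
  \sum_(k < n) inner (applyop S (K k) psi) (applyop S (K k) phi) = inner psi phi.
Proof.
move=> cK.
transitivity (\sum_(x : basis Q) \sum_(y : basis Q)
   (\sum_(k < n) \sum_(z : basis Q) ((opmat S (K k) z x)^*)%C * opmat S (K k) z y)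
   * (((psi x)^*)%C * phi y)); last first.
  apply: eq_bigr => x _; rewrite (bigD1 x) //= cK eqxx mul1r big1 ?addr0 //.
  by move=> y yx; rewrite cK eq_sym (negbTE yx) mul0r.
have -> : \sum_(k < n) inner (applyop S (K k) psi) (applyop S (K k) phi) =
  \sum_(k < n) \sum_(x : basis Q) \sum_(y : basis Q) \sum_(z : basis Q)
    ((opmat S (K k) z x)^*)%C * opmat S (K k) z y * (((psi x)^*)%C * phi y).
  apply: eq_bigr => k _; rewrite /inner.
  transitivity (\sum_(z : basis Q) \sum_(x : basis Q) \sum_(y : basis Q)
    ((opmat S (K k) z x)^*)%C * opmat S (K k) z y * (((psi x)^*)%C * phi y)).
    apply: eq_bigr => z _; rewrite !ffunE conjc_sum mulr_suml.
    apply: eq_bigr => x _; rewrite mulr_sumr; apply: eq_bigr => y _.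
    by rewrite conjcM mulrACA.
  by rewrite exchange_big; apply: eq_bigr => x _; rewrite exchange_big.
rewrite exchange_big; apply: eq_bigr => x _.
rewrite exchange_big; apply: eq_bigr => y _.
by rewrite mulr_suml; apply: eq_bigr => k _; rewrite mulr_suml.
Qed.

Lemma kraus_norm2 (S : {set Q}) n (K : 'I_n -> locmat R Q) psi :
  complete_kraus S K -> \sum_(k < n) norm2 (applyop S (K k) psi) = norm2 psi.
Proof.
move=> cK; rewrite norm2_Re -(kraus_inner _ _ cK) Re_sum.
by apply: eq_bigr => k _; rewrite norm2_Re.
Qed.

(** An operator on one qubit changes only the factor of that qubit. *)
Lemma product_vec_applyop (q : Q) u pi :
  product_vec pi -> product_vec (applyop [set q] u pi).
Proof.
(* The singleton is viewed as the image of [unit], so the sum over updates runs over a single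
   bit. *)
move=> [v vE]; pose e (_ : unit) := q.
have SE : [set q] =i codom e.
  move=> q'; rewrite inE; apply/eqP/codomP => [->|[_ ->] //]; by exists tt.
have e_inj : injective e by case; case.
pose w b := \sum_(s : basis unit)
  u [ffun q' => (q' == q) && b] (upd e [ffun => false] s) * v q (s tt).
exists (fun q' => if q' == q then w else v q') => x.
rewrite (applyop_upd e_inj _ _ _ SE) (bigD1 q) //= eqxx /w mulr_suml.
apply: eq_bigr => s _; rewrite vE (bigD1 q) //= -mulrA; congr (_ * (_ * _)).
- congr (u _ _); apply/ffunP => q'; rewrite !ffunE inE.
  by case: eqP => // ->.
- by rewrite -[q in upd _ _ _ q]/(e tt) upd_in.
apply: eq_bigr => q' qq'; rewrite (negbTE qq') upd_out // -SE inE //.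
Qed.

(** The factor of one qubit absorbs the scalar; on an empty qubit set the only product vector is the
    constant 1. *)
Lemma product_vec_scale c pi : Q -> product_vec pi -> product_vec (scalev c pi).
Proof.
move=> q [v vE]; exists (fun q' b => if q' == q then c * v q' b else v q' b) => x.
rewrite ffunE vE (bigD1 q) // [RHS](bigD1 q) //= eqxx mulrA; congr (_ * _).
by apply: eq_bigr => q' /negbTE ->.
Qed.

(* Linearizing the bound |<pi|psi>| <= s ||pi|| ||psi|| by AM-GM makes it
   additive over the branches of a measurement. *)
Lemma locc_overlap phi s (p : protocol R Q) psi :
  0 <= s -> normalized phi ->
  (forall pi, product_vec pi -> sqmod (inner pi phi) <= s ^+ 2 * norm2 pi) ->
  valid_protocol p ->
  (forall v, v \in outcomes p psi -> exists c : C, v = scalev c phi) ->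
  forall pi, product_vec pi ->
    2 * complex.Re (inner pi psi) <= s * (norm2 pi + norm2 psi).
Proof.
move=> s0 phi1 bound; elim: p psi => [|q n K next IH] psi /=.
  move=> _ h pi ppi; have [c ->] := h psi (mem_head _ _).
  rewrite inner_scaler norm2_scale phi1 mulr1.
  set z := inner pi phi.
  have hz : sqmod z <= s ^+ 2 * norm2 pi by exact: bound.
  have hc := sqmod_ge0 c; have hp := norm2_ge0 pi.
  have h1 : (complex.Re (c * z)) ^+ 2 <= sqmod c * (s ^+ 2 * norm2 pi).
    apply: (@le_trans _ _ (sqmod (c * z))); first by rewrite lerDl sqr_ge0.
    by rewrite sqmodM ler_wpM2l.
  have hr : 0 <= s * (norm2 pi + sqmod c) by rewrite mulr_ge0 // addr_ge0.
  (* Both sides are squared; what remains is $4ab \le (a+b)^2$ for [norm2 pi] and [sqmod c], scaled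
     by $s^2$. *)
  apply: (@le_trans _ _ `|2 * complex.Re (c * z)|); first exact: ler_norm.
  rewrite -(ler_pXn2r (n := 2)) ?nnegrE ?normr_ge0 // real_normK ?num_real //.
  have := mulr_ge0 (sqr_ge0 s) (sqr_ge0 (norm2 pi - sqmod c)); nra.
move=> [cK vn] h pi ppi.
(* The test vector [pi] is sent through the same measurement as [psi]: it stays a product vector in
   every branch, and completeness splits both sides into sums over the branches. *)
rewrite -(kraus_inner pi psi cK) -(kraus_norm2 pi cK) -(kraus_norm2 psi cK).
rewrite Re_sum mulr_sumr -big_split mulr_sumr; apply: ler_sum => k _.
apply: (IH k) => //; last exact: product_vec_applyop.
move=> v vin; apply: h; apply/flattenP; exists (outcomes (next k) (applyop [set q] (K k) psi)) => //.
by apply/mapP; exists k => //; rewrite mem_enum.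
Qed.

(** The Schmidt measure is [log2] of the least such [k]. *)
Definition product_rank_le (k : nat) psi : Prop :=
  exists phis : 'I_k -> qstate R Q,
    (forall j, product_vec (phis j)) /\ psi = [ffun x => \sum_(j < k) phis j x].

Lemma product_rank_applyop k q u psi :
  product_rank_le k psi -> product_rank_le k (applyop [set q] u psi).
Proof.
move=> [phis [pp ->]]; exists (fun j => applyop [set q] u (phis j)); split.
  by move=> j; exact: product_vec_applyop.
apply/ffunP => x; rewrite !ffunE; under [RHS]eq_bigr do rewrite ffunE.
rewrite exchange_big; apply: eq_bigr => y _.
by rewrite ffunE mulr_sumr.
Qed.

(** Since the squared norms of the branches add up, some branch is non-zero at each measurement.
    Following it, product terms stay product terms, and the leaf reached is a non-zero multiple of
    [phi], so the scalar can be divided out. *)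
Lemma locc_product_rank phi k (p : protocol R Q) psi : Q ->
  valid_protocol p ->
  (forall v, v \in outcomes p psi -> exists c : C, v = scalev c phi) ->
  norm2 psi != 0 -> product_rank_le k psi -> product_rank_le k phi.
Proof.
move=> q0; elim: p psi => [|q n K next IH] psi /=.
  move=> _ h npsi [phis [pp psiE]].
  have [c cE] := h psi (mem_head _ _).
  have c0 : c != 0.
    by apply: contraNneq npsi => c0; rewrite cE norm2_scale c0 sqmod0 mul0r.
  exists (fun j => scalev c^-1 (phis j)); split.
    by move=> j; exact: product_vec_scale.
  apply/ffunP => x; rewrite ffunE; under eq_bigr do rewrite ffunE.
  rewrite -mulr_sumr; have /ffunP/(_ x) := psiE; rewrite ffunE => <-.
  by rewrite cE ffunE mulKf.
move=> [cK vn] h npsi rk.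
have [k' hk'] : exists k', norm2 (applyop [set q] (K k') psi) != 0.
  apply: contrapT => hn; move: npsi; rewrite -(kraus_norm2 psi cK) big1 ?eqxx //.
  by move=> k' _; apply/eqP/negPn/negP => hk'; apply: hn; exists k'.
apply: (IH k' _ (vn k') _ hk'); last exact: product_rank_applyop.
move=> v vin; apply: h; apply/flattenP.
exists (outcomes (next k') (applyop [set q] (K k') psi)) => //.
by apply/mapP; exists k' => //; rewrite mem_enum.
Qed.

End Locc.

End ComplexAmplitudes.

(** * Block encodings *)

Section Encoding.
Variable R : realType.
Local Notation C := (R[i]).

(** * Orthonormal families and Bessel's inequality *)

Section LinearCombination.
Variables (T Q : finType) (f : T -> qstate R Q).

Definition lincomb (a : T -> C) : qstate R Q := [ffun x => \sum_c a c * f c x].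

Lemma inner_lincombr v a : inner v (lincomb a) = \sum_c a c * inner v (f c).
Proof.
rewrite /inner; under eq_bigr do rewrite [X in _ * X]ffunE mulr_sumr.
rewrite exchange_big; apply: eq_bigr => c _; rewrite mulr_sumr.
by apply: eq_bigr => x _; rewrite mulrCA.
Qed.

Lemma inner_lincombl v a :
  inner (lincomb a) v = \sum_c ((a c)^*)%C * inner (f c) v.
Proof.
rewrite inner_conj inner_lincombr conjc_sum; apply: eq_bigr => c _.
by rewrite conjcM -inner_conj.
Qed.

Hypothesis f_ortho : forall c c', inner (f c) (f c') = (c == c')%:R.

Lemma inner_ortho_lincomb c a : inner (f c) (lincomb a) = a c.
Proof.
rewrite inner_lincombr (bigD1 c) //= f_ortho eqxx mulr1 big1 ?addr0 //.
by move=> c' cc'; rewrite f_ortho eq_sym (negbTE cc') mulr0.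
Qed.

Lemma inner_lincomb a b :
  inner (lincomb a) (lincomb b) = \sum_c ((a c)^*)%C * b c.
Proof.
by rewrite inner_lincombl; apply: eq_bigr => c _; rewrite inner_ortho_lincomb.
Qed.

(** The residual [w] of [v] after orthogonal projection has non-negative squared norm. *)
Lemma bessel v : \sum_c sqmod (inner (f c) v) <= norm2 v.
Proof.
pose a c := inner (f c) v; pose w := qadd v (qopp (lincomb a)).
have aE : ((\sum_c sqmod (a c))%:C)%C = \sum_c ((a c)^*)%C * a c.
  by rewrite (rmorph_sum (real_complex R)) /=; apply: eq_bigr => c _; exact: sqmodE.
have lv : inner (lincomb a) v = ((\sum_c sqmod (a c))%:C)%C.
  by rewrite inner_lincombl aE.
have : 0 <= norm2 w by exact: norm2_ge0.
rewrite norm2_Re /w !inner_addl !inner_addr !inner_oppl !inner_oppr.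
rewrite inner_lincomb -aE lv (inner_conj (lincomb a) v) lv conjc_real.
rewrite opprK addNr addr0 -norm2E -(rmorphB (real_complex R)) /=.
by rewrite subr_ge0.
Qed.

End LinearCombination.

(** * Embedding into a larger qubit set, and its adjoint *)

Section Embedding.
Variables (Q' Q : finType) (e : Q' -> Q).
Hypothesis e_inj : injective e.

(** The adjoint of [embed e]: every qubit outside the image of [e] is projected on |0>. *)
Definition pullback (v : qstate R Q) : qstate R Q' :=
  [ffun y => v (upd e [ffun => false] y)].

Lemma inner_embedl (phi : qstate R Q') v : inner (embed e phi) v = inner phi (pullback v).
Proof.
pose S := [set q | q \in codom e].
have SE : S =i codom e by move=> q; rewrite inE.
transitivity (\sum_(x : basis Q |
    [forall q, (q \notin S) ==> ([ffun => false] q == x q :> bool)])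
    ((phi [ffun q' => x (e q')])^*)%C * v x).
  rewrite /inner [RHS]big_mkcond; apply: eq_bigr => x _; rewrite ffunE.
  have -> : [forall q, (q \notin S) ==> ([ffun => false] q == x q :> bool)] =
            [forall q, (q \notin codom e) ==> ~~ x q].
    by apply: eq_forallb => q; rewrite SE ffunE; case: (x q).
  by case: ifP => // _; rewrite conjc0 mul0r.
rewrite (sum_upd e_inj _ _ SE); apply: eq_bigr => y _; rewrite ffunE.
by congr ((phi _)^*%C * _); apply/ffunP => q'; rewrite ffunE upd_in.
Qed.

Lemma pullback_embed (phi : qstate R Q') : pullback (embed e phi) = phi.
Proof.
apply/ffunP => y; rewrite !ffunE ifT.
  by congr (phi _); apply/ffunP => q; rewrite ffunE upd_in.
by apply/forallP => q; apply/implyP => h; rewrite upd_out // ffunE.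
Qed.

Lemma inner_embed (phi phi' : qstate R Q') : inner (embed e phi) (embed e phi') = inner phi phi'.
Proof. by rewrite inner_embedl pullback_embed. Qed.

(** The qubits outside the image contribute only the scalar [s], the product of their amplitudes at
    0. *)
Lemma pullback_product v : Q' -> product_vec v -> product_vec (pullback v).
Proof.
move=> q0 [w wE]; pose s := \prod_(q | q \notin codom e) w q false.
have -> : pullback v =
    scalev s [ffun y : basis Q' => \prod_(q' : Q') w (e q') (y q')].
  apply/ffunP => y; rewrite !ffunE wE (bigID (fun q => q \in codom e)) /= mulrC.
  congr (_ * _).
    by apply: eq_bigr => q h; rewrite upd_out // ffunE.
  rewrite -big_filter (perm_big (codom e)) /=.
    by rewrite big_map big_enum; apply: eq_bigr => q' _; rewrite upd_in.
  apply: uniq_perm; first by rewrite filter_uniq // index_enum_uniq.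
    by rewrite map_inj_uniq // enum_uniq.
  by move=> q; rewrite mem_filter mem_index_enum andbT.
apply: product_vec_scale => //; exists (fun q' => w (e q')) => y.
by rewrite ffunE.
Qed.

End Embedding.

(** * Tensor products over blocks *)

Section Blocks.
Variables (I J : finType).
Implicit Types (L : I -> bool -> qstate R J) (phi : qstate R I).

Definition rowb (x : basis (I * J)%type) (i : I) : basis J := [ffun k => x (i, k)].

(** A string on [I * J] is an independent choice of one row per block, so this is distributivity. *)
Lemma sum_rows (F : I -> basis J -> C) :
  \sum_(x : basis (I * J)%type) \prod_i F i (rowb x i) =
  \prod_i \sum_(s : basis J) F i s.
Proof.
rewrite bigA_distr_bigA /=.
pose h (g : {ffun I -> basis J}) : basis (I * J)%type := [ffun p => g p.1 p.2].
pose h' (x : basis (I * J)%type) : {ffun I -> basis J} := [ffun i => rowb x i].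
have hK : cancel h h' by move=> g; apply/ffunP => i; apply/ffunP => k; rewrite !ffunE.
have h'K : cancel h' h by move=> x; apply/ffunP => -[i k]; rewrite !ffunE.
rewrite (reindex h) /=; last by exists h' => x _; [exact: hK | exact: h'K].
apply: eq_bigr => g _; apply: eq_bigr => i _; congr (F i _).
by apply/ffunP => k; rewrite !ffunE.
Qed.

(** The logical states may depend on the block [i], so that an encoding can be changed one block at
    a time. *)
Definition logical_ket L (c : basis I) : qstate R (I * J)%type :=
  [ffun x => \prod_i L i (c i) (rowb x i)].

Definition encode_blocks L phi : qstate R (I * J)%type :=
  lincomb (logical_ket L) phi.

Definition orthonormal_pairs L :=
  forall i b b', inner (L i b) (L i b') = (b == b')%:R.

Lemma inner_logical_ket L c L' c' :
  inner (logical_ket L c) (logical_ket L' c') =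
  \prod_i inner (L i (c i)) (L' i (c' i)).
Proof.
rewrite [LHS]/inner; under [LHS]eq_bigr do rewrite !ffunE conjc_prod -big_split.
by rewrite (sum_rows (fun i s => ((L i (c i) s)^*)%C * L' i (c' i) s)).
Qed.

Lemma logical_ket_ortho L c c' : orthonormal_pairs L ->
  inner (logical_ket L c) (logical_ket L c') = (c == c')%:R.
Proof.
move=> oL; rewrite inner_logical_ket.
rewrite (eq_bigr (fun i => (c i == c' i)%:R)); last by move=> i _; exact: oL.
have [->|] := eqVneq c c'; first by rewrite big1 // => i _; rewrite eqxx.
move=> cc'; have [i hi] : exists i, c i != c' i.
  apply: contrapT => h; move/eqP: cc'; apply; apply/ffunP => i.
  by apply/eqP/negPn/negP => hi; apply: h; exists i.
by rewrite (bigD1 i) //= (negbTE hi) mul0r.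
Qed.

Lemma norm2_encode_blocks L phi : orthonormal_pairs L ->
  norm2 (encode_blocks L phi) = norm2 phi.
Proof.
move=> oL; rewrite !norm2_Re inner_lincomb //.
by move=> c c'; exact: logical_ket_ortho.
Qed.

(** * The adjoint of an embedded encoding *)

Section Decoding.
Variables (Q : finType) (e : I * J -> Q) (L : I -> bool -> qstate R J).
Hypothesis e_inj : injective e.
Hypothesis oL : orthonormal_pairs L.

Definition decode_blocks (v : qstate R Q) : qstate R I :=
  [ffun c => inner (embed e (logical_ket L c)) v].

Let ortho c c' :
  inner (embed e (logical_ket L c)) (embed e (logical_ket L c')) = (c == c')%:R.
Proof. by rewrite inner_embed // logical_ket_ortho. Qed.

Lemma embed_encode phi :
  embed e (encode_blocks L phi) = lincomb (fun c => embed e (logical_ket L c)) phi.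
Proof.
apply/ffunP => x; rewrite !ffunE; under [RHS]eq_bigr do rewrite ffunE.
case: ifP => _; last by rewrite big1 // => c _; rewrite mulr0.
by [].
Qed.

Lemma decode_encode phi : decode_blocks (embed e (encode_blocks L phi)) = phi.
Proof.
by apply/ffunP => c; rewrite ffunE embed_encode inner_ortho_lincomb.
Qed.

Lemma norm2_decode v : norm2 (decode_blocks v) <= norm2 v.
Proof.
apply: le_trans (bessel ortho v); rewrite le_eqVlt; apply/orP; left; apply/eqP.
by apply: eq_bigr => c _; rewrite ffunE.
Qed.

Lemma inner_decode v phi :
  inner v (embed e (encode_blocks L phi)) = inner (decode_blocks v) phi.
Proof.
rewrite embed_encode inner_lincombr; apply: eq_bigr => c _.
by rewrite ffunE -inner_conj mulrC.
Qed.

(** The overlap of a product vector with a logical ket factorizes over the blocks, and the factor of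
    block [i] depends on [c i] alone. The logical states may be entangled inside a block, since a
    whole block becomes one qubit. *)
Lemma decode_product v : I -> J -> product_vec v -> product_vec (decode_blocks v).
Proof.
move=> i0 k0 /(pullback_product e_inj (i0, k0)) [w wE].
exists (fun i b => inner (L i b) [ffun s : basis J => \prod_k w (i, k) (s k)]) => c.
rewrite ffunE inner_embedl // /inner.
rewrite -(sum_rows (fun i s => ((L i (c i) s)^*)%C *
                    [ffun s : basis J => \prod_k w (i, k) (s k)] s)).
apply: eq_bigr => x _; rewrite ffunE conjc_prod wE big_split /=; congr (_ * _).
rewrite (eq_bigr (fun q => w (q.1, q.2) (x (q.1, q.2)))); last by case.
rewrite -(pair_bigA _ (fun i k => w (i, k) (x (i, k)))) /=.
apply: eq_bigr => i _; rewrite ffunE; apply: eq_bigr => k _.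
by rewrite ffunE.
Qed.

Lemma decode_rank k v : I -> J ->
  product_rank_le k v -> product_rank_le k (decode_blocks v).
Proof.
move=> i0 k0 [phis [pp ->]]; exists (fun j => decode_blocks (phis j)); split.
  by move=> j; exact: decode_product.
apply/ffunP => c; rewrite !ffunE /inner; under eq_bigr do rewrite [X in _ * X]ffunE mulr_sumr.
by rewrite exchange_big; apply: eq_bigr => j _; rewrite ffunE.
Qed.

End Decoding.
End Blocks.

Lemma encodeE n m (zero one : qstate R 'I_m) (phi : qstate R 'I_n) :
  encode zero one phi =
  encode_blocks (fun _ b => if b then one else zero) phi.
Proof.
apply/ffunP => x; rewrite !ffunE; apply: eq_bigr => c _; rewrite ffunE.
by congr (_ * _); apply: eq_bigr => j _; case: (c j).
Qed.

(** * Relabelling of qubits *)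

Section Relabel.
Variables (Q Q' : finType) (f : Q -> Q') (g : Q' -> Q).
Hypotheses (fK : cancel f g) (gK : cancel g f).

Lemma relabelK (v : qstate R Q') : relabel f (relabel g v) = v.
Proof.
apply/ffunP => x; rewrite !ffunE; congr (v _).
by apply/ffunP => q; rewrite !ffunE gK.
Qed.

Lemma inner_relabel (a b : qstate R Q) :
  inner (relabel f a) (relabel f b) = inner a b.
Proof.
pose h (x : basis Q) : basis Q' := [ffun q => x (g q)].
pose h' (x : basis Q') : basis Q := [ffun q => x (f q)].
rewrite /inner (reindex h) /=.
  by apply: eq_bigr => x _; rewrite !ffunE; congr ((a _)^*%C * b _);
    apply/ffunP => q; rewrite !ffunE fK.
by exists h' => x _; apply/ffunP => q; rewrite !ffunE ?fK ?gK.
Qed.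

Lemma norm2_relabel (a : qstate R Q) : norm2 (relabel f a) = norm2 a.
Proof. by rewrite !norm2_Re inner_relabel. Qed.

Lemma product_vec_relabel (a : qstate R Q) :
  product_vec a -> product_vec (relabel f a).
Proof.
move=> [v vE]; exists (fun q => v (g q)) => x; rewrite ffunE vE.
rewrite (reindex f) /=; last by exists g => q _; rewrite ?fK ?gK.
by apply: eq_bigr => q _; rewrite ffunE fK.
Qed.

Lemma product_rank_relabel k (a : qstate R Q) :
  product_rank_le k a -> product_rank_le k (relabel f a).
Proof.
move=> [phis [pp ->]]; exists (fun j => relabel f (phis j)); split.
  by move=> j; exact: product_vec_relabel.
by apply/ffunP => x; rewrite !ffunE; apply: eq_bigr => j _; rewrite ffunE.
Qed.

End Relabel.
End Encoding.

(** * Bell pairs *)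

Section Bell.
Variable R : realType.
Local Notation C := (R[i]).

Lemma sum_basis_bool (F : basis bool -> C) :
  \sum_s F s = \sum_(a : bool) \sum_(b : bool) F [ffun i => if i then b else a].
Proof.
rewrite pair_big /=.
rewrite (reindex (fun p : bool * bool => [ffun i => if i then p.2 else p.1])) //=.
exists (fun s : basis bool => (s false, s true)) => [[a b] _|s _].
  by rewrite !ffunE.
by apply/ffunP => -[]; rewrite ffunE.
Qed.

Definition bell_pair : qstate R bool :=
  [ffun s : basis bool => if s false == s true then (((Num.sqrt 2)^-1)%:C)%C else 0].

(** The $k$-fold tensor power, as a logical ket whose two logical states are both [bell_pair]. *)
Definition bell_pairs (k : nat) : qstate R ('I_k * bool)%type :=
  logical_ket (fun _ _ => bell_pair) [ffun => false].

Lemma sqr_half_sqrt : (Num.sqrt 2)^-1 ^+ 2 = 2^-1 :> R.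
Proof. by rewrite exprVn sqr_sqrtr. Qed.

Lemma bell_pair_inner (v : qstate R bool) :
  inner v bell_pair = (((Num.sqrt 2)^-1)%:C)%C *
    ((v [ffun => false])^*%C + (v [ffun => true])^*%C).
Proof.
rewrite /inner sum_basis_bool !big_bool !ffunE /= !mulr0 add0r addr0 mulrDr.
rewrite addrC ![((Num.sqrt 2)^-1)%:C%C * _]mulrC.
by congr ((v _)^*%C * _ + (v _)^*%C * _); apply/ffunP => -[]; rewrite !ffunE.
Qed.

Lemma bell_pairs_normalized k : normalized (bell_pairs k).
Proof.
rewrite /normalized norm2_Re inner_logical_ket big1 // => j _.
rewrite bell_pair_inner !ffunE eqxx conjc_real mulrDr -rmorphM -rmorphD /=.
by rewrite -expr2 sqr_half_sqrt; congr (_%:C)%C; field.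
Qed.

Lemma norm2_product (Q : finType) (a : qstate R Q) (v : Q -> bool -> C) :
  (forall x, a x = \prod_q v q (x q)) ->
  norm2 a = \prod_q (sqmod (v q false) + sqmod (v q true)).
Proof.
move=> vE; rewrite (eq_bigr (fun q => \sum_(b : bool) sqmod (v q b))).
  by rewrite bigA_distr_bigA; apply: eq_bigr => x _; rewrite vE sqmod_prod.
by move=> q _; rewrite big_bool addrC.
Qed.

Lemma prod_pairs (A : comPzSemiRingType) k (F : 'I_k * bool -> A) :
  \prod_p F p = \prod_j (F (j, false) * F (j, true)).
Proof.
rewrite (eq_bigr (fun p => F (p.1, p.2))); last by case.
rewrite -(pair_bigA _ (fun j b => F (j, b))) /=.
by apply: eq_bigr => j _; rewrite big_bool mulrC.
Qed.

(** The overlap factorizes over the pairs. Each pair contributes a factor 1/2 from the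
    normalization, times a two-term sum bounded by Cauchy-Schwarz. *)
Lemma bell_pairs_overlap k (a : qstate R ('I_k * bool)%type) : product_vec a ->
  sqmod (inner a (bell_pairs k)) <= 2^-1 ^+ k * norm2 a.
Proof.
move=> [v vE].
pose w j : qstate R bool :=
  [ffun s : basis bool => v (j, false) (s false) * v (j, true) (s true)].
have -> : a = logical_ket (fun j _ => w j) [ffun => false].
  apply/ffunP => x; rewrite ffunE vE prod_pairs; apply: eq_bigr => j _.
  by rewrite !ffunE.
rewrite inner_logical_ket sqmod_prod.
rewrite (@norm2_product _ _ v); last first.
  by move=> x; rewrite ffunE prod_pairs; apply: eq_bigr => j _; rewrite !ffunE.
rewrite prod_pairs -[X in 2^-1 ^+ X](card_ord k) -prodr_const -big_split /=.
apply: ler_prod => j _; rewrite sqmod_ge0 /= bell_pair_inner sqmodM sqmod_real.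
rewrite sqr_half_sqrt ler_pM2l ?invr_gt0 ?ltr0n // -conjcD sqmod_conj.
by rewrite !ffunE; exact: sqmod_pair_le.
Qed.

(** Arrange the amplitudes in a matrix, with rows indexed by the first qubits of the pairs and
    columns by the second ones. It is a non-zero multiple of the identity of size $2^k$, while [K]
    product terms factor it as [G *m H] through dimension [K]. *)
Lemma bell_pairs_rank k K : product_rank_le K (bell_pairs k) -> (2 ^ k <= K)%N.
Proof.
move=> [phis [pp bE]].
have /choice [v vE] : forall j, exists v : 'I_k * bool -> bool -> C,
  forall x, phis j x = \prod_p v p (x p) by move=> j; have [v] := pp j; exists v.
pose T := basis 'I_k; pose n := #|T|.
have nE : n = (2 ^ k)%N by rewrite /n card_ffun card_bool card_ord.
(* The string with [s] on the first qubits and [t] on the second qubits of the pairs. *)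
pose st (s t : T) : basis ('I_k * bool)%type :=
  [ffun p => if p.2 then t p.1 else s p.1].
pose G : 'M[C]_(n, K) :=
  \matrix_(i, j) \prod_l v j (l, false) ((enum_val i : T) l).
pose H : 'M[C]_(K, n) :=
  \matrix_(j, i) \prod_l v j (l, true) ((enum_val i : T) l).
pose r : C := (((Num.sqrt 2)^-1)%:C)%C.
have r0 : r != 0.
  apply/eqP => -[] /eqP; rewrite invr_eq0 sqrtr_eq0; apply/negP.
  by rewrite -ltNge ltr0n.
have GH : G *m H = (r ^+ k)%:M.
  apply/matrixP => i i'; rewrite !mxE.
  have /ffunP/(_ (st (enum_val i) (enum_val i'))) := bE; rewrite [RHS]ffunE.
  under [RHS]eq_bigr do rewrite vE prod_pairs big_split.
  move=> E; under eq_bigr do rewrite mxE mxE.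
  transitivity (\prod_(l < k)
     (if (enum_val i : T) l == (enum_val i' : T) l then r else 0)); last first.
    have [->|ii'] := eqVneq i i'.
      rewrite (eq_bigr (fun=> r)); last by move=> l _; rewrite eqxx.
      by rewrite prodr_const card_ord mulr1n.
    have [l hl] : exists l, (enum_val i : T) l != (enum_val i' : T) l.
      apply: contrapT => h; move/eqP: ii'; apply; apply: enum_val_inj.
      by apply/ffunP => l; apply/eqP/negPn/negP => hl; apply: h; exists l.
    by rewrite (bigD1 l) //= (negbTE hl) mul0r mulr0n.
  transitivity (\sum_(j < K) (\prod_l v j (l, false) (st (enum_val i) (enum_val i') (l, false))) *
     (\prod_l v j (l, true) (st (enum_val i) (enum_val i') (l, true)))).
    by apply: eq_bigr => j _; congr (_ * _); apply: eq_bigr => l _; rewrite ffunE.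
  by rewrite -E ffunE; apply: eq_bigr => l _; rewrite !ffunE.
rewrite -nE; apply: leq_trans (rank_leq_col G).
apply: leq_trans (mxrankM_maxl G H); rewrite GH.
by rewrite mxrank_unit // -scalemx1 unitmxZ ?unitmx1 // unitfE expf_neq0.
Qed.

End Bell.

(** * The Schmidt and geometric measures of a resource *)

Section BellConsequences.
Variable R : realType.

(** On no qubits there is a single bit string, so the inner product of two unit vectors is a product
    of two non-zero amplitudes. *)
Lemma orthogonal_inhabited m (zero one : qstate R 'I_m) :
  normalized zero -> normalized one -> inner zero one = 0 -> (0 < m)%N.
Proof.
case: m zero one => // zero one z1 o1 io.
have [x hx] := normalized_nz z1; have [y hy] := normalized_nz o1.
have E : forall z : basis 'I_0, z = x by move=> z; apply/ffunP => -[].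
move: io; rewrite /inner (big_pred1 x) => [|z]; last by rewrite /= (E z) eqxx.
by move/eqP; rewrite mulf_eq0 conjc_eq0 (negbTE hx) -(E y) (negbTE hy).
Qed.

Lemma logical_pair_ortho m n (zero one : qstate R 'I_m) :
  normalized zero -> normalized one -> inner zero one = 0 ->
  orthonormal_pairs (fun (_ : 'I_n) b => if b then one else zero).
Proof.
move=> z1 o1 io _ [] [] /=; rewrite -?norm2E ?z1 ?o1 //.
by rewrite inner_conj io conjc0.
Qed.

(** The common input for [E_s] and [E_g]: universality is applied to $k$ Bell pairs, and both Bell
    bounds are carried to the encoded state [Phi] by decoding. *)
Lemma resource_bell (Es : nat -> finType) (incl : forall i, Es i -> Es i.+1)
    (psi : forall i, qstate R (Es i)) (k : nat) :
  (0 < k)%N -> encoded_universal_resource incl psi ->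
  exists i (Phi : qstate R (Es i)),
    [/\ inhabited (Es i), locc_exact (psi i) Phi, normalized Phi,
        (forall pi, product_vec pi ->
           sqmod (inner pi Phi) <= 2^-1 ^+ k * norm2 pi)
      & (forall K, product_rank_le K Phi -> (2 ^ k <= K)%N)].
Proof.
move=> k0 [m [zero [one [nb [emb [[z1 o1 io] emb_bij _ univ]]]]]].
(* Universality speaks of qubits indexed by an ordinal, so the qubits of the pairs are
   enumerated. *)
pose rk := @enum_rank ('I_k * bool)%type; pose vl := @enum_val ('I_k * bool)%type predT.
have rkK : cancel rk vl by exact: enum_rankK.
have vlK : cancel vl rk by exact: enum_valK.
pose phi := relabel rk (bell_pairs R k).
have phi1 : normalized phi.
  by rewrite /normalized (norm2_relabel rkK vlK); exact: bell_pairs_normalized.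
have [i [b [b_inj]]] := univ _ phi phi1.
set e := fun jk : _ * 'I_m => emb i (b jk.1, jk.2).
have e_inj : injective e.
  by move=> [j1 k1] [j2 k2] /(bij_inj (emb_bij i)) [/b_inj -> ->].
rewrite encodeE; set L := (X in encode_blocks X _); set Phi := embed _ _ => hlocc.
have oL : orthonormal_pairs L by exact: logical_pair_ortho.
(* [0 < k] and [0 < m] exhibit a qubit of the encoded state, which can absorb scalars. *)
pose j0 : 'I_#|{: 'I_k * bool}| := rk (Ordinal k0, false).
pose k1 : 'I_m := Ordinal (orthogonal_inhabited z1 o1 io).
exists i, Phi; split => //.
- by split; exact: (e (j0, k1)).
- rewrite /normalized norm2_Re inner_embed // -norm2_Re norm2_encode_blocks //.
- move=> pi ppi; rewrite inner_decode // -(relabelK vlK (decode_blocks e L pi)).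
  rewrite (inner_relabel rkK vlK).
  apply: le_trans (bell_pairs_overlap _) _.
    by apply: (product_vec_relabel vlK rkK); exact: decode_product.
  by rewrite (norm2_relabel vlK rkK) ler_wpM2l ?exprn_ge0 ?invr_ge0 ?ler0n ?norm2_decode.
move=> K /(decode_rank L e_inj j0 k1); rewrite decode_encode //.
move/(product_rank_relabel vlK rkK); rewrite relabelK //.
exact: bell_pairs_rank.
Qed.

Lemma log2_exp2 (n : nat) : log2 (2 ^+ n : R) = n%:R.
Proof.
rewrite /log2 lnXn ?ltr0n // -[X in X / _]mulr_natl mulfK //.
by rewrite gt_eqF // ln_gt0 // ltr1n.
Qed.

Lemma ler_log2 (x y : R) : 0 < x -> x <= y -> log2 x <= log2 y.
Proof.
move=> x0 xy; rewrite ler_pM2r ?invr_gt0 ?ln_gt0 ?ltr1n //.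
by rewrite ler_ln ?posrE // (lt_le_trans x0).
Qed.

Lemma Efam_pinfty (F : forall Q : finType, qstate R Q -> \bar R)
    (Es : nat -> finType) (psi : forall i, qstate R (Es i)) :
  (forall k : nat, (0 < k)%N -> exists i, (k%:R%:E <= F (Es i) (psi i))%E) ->
  Efam F psi = +oo%E.
Proof.
move=> h; apply/eqyP => A A0; have Ak := archi_boundP (ltW A0).
have [|i hi] := h (Num.bound A); first by rewrite -(ltr0n R) (lt_trans A0).
apply: (@le_trans _ _ (Num.bound A)%:R%:E); first by rewrite lee_fin ltW.
by apply: le_trans hi _; apply: ereal_sup_ubound; exists i.
Qed.

Lemma Efam_Es (Es : nat -> finType) (incl : forall i, Es i -> Es i.+1)
    (psi : forall i, qstate R (Es i)) :
  (forall i, normalized (psi i)) -> encoded_universal_resource incl psi ->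
  Efam (@E_s R) psi = +oo%E.
Proof.
move=> n1 res; apply: Efam_pinfty => k k0.
have [i [Phi [[q] [p [vp hp]] Phi1 _ rk]]] := resource_bell k0 res.
exists i; apply: le_ereal_inf_tmp => _ [K [-> dec]].
(* A decomposition of [psi i] into [K] product vectors is carried along the protocol to one of
   [Phi]. *)
have hK : (2 ^ k <= K)%N.
  apply: rk; apply: (locc_product_rank q vp hp) => //.
  by rewrite (n1 i) oner_eq0.
by rewrite lee_fin -(log2_exp2 k) ler_log2 ?exprn_gt0 // -natrX ler_nat.
Qed.

Lemma product_state_vec (Q : finType) (phi : qstate R Q) : product_state phi ->
  product_vec phi /\ norm2 phi = 1.
Proof.
move=> [v [v1 vE]]; split; first by exists v.
by rewrite (norm2_product vE) big1.
Qed.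

(** Basis states make the supremum in [E_g] positive, as its logarithm requires. *)
Lemma product_state_ket (Q : finType) (c : basis Q) : product_state (ket R c).
Proof.
exists (fun q b => (b == c q)%:R); split.
  by move=> q; case: (c q); rewrite sqmod0 sqmod1 ?addr0 ?add0r.
move=> x; rewrite ffunE; have [->|] := eqVneq x c.
  by rewrite big1 // => q _; rewrite eqxx.
move=> xc; have [q hq] : exists q, x q != c q.
  apply: contrapT => h; move/eqP: xc; apply; apply/ffunP => q.
  by apply/eqP/negPn/negP => hq; apply: h; exists q.
by rewrite (bigD1 q) //= (negbTE hq) mul0r.
Qed.

Lemma inner_ket (Q : finType) (c : basis Q) (psi : qstate R Q) :
  inner psi (ket R c) = ((psi c)^*)%C.
Proof.
rewrite /inner (bigD1 c) //= ffunE eqxx mulr1 big1 ?addr0 // => x xc.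
by rewrite ffunE (negbTE xc) mulr0.
Qed.

Lemma Efam_Eg (Es : nat -> finType) (incl : forall i, Es i -> Es i.+1)
    (psi : forall i, qstate R (Es i)) :
  (forall i, normalized (psi i)) -> encoded_universal_resource incl psi ->
  Efam (@E_g R) psi = +oo%E.
Proof.
move=> n1 res; apply: Efam_pinfty => k k0.
(* With $2k$ pairs the squared overlap with [Phi] is at most $s^2$ for $s = 2^{-k}$; the argument
   below derives the bound $s$ for [psi i], which suffices for $E_g \ge k$. *)
have k20 : (0 < k + k)%N by rewrite addn_gt0 k0.
have [i [Phi [[q] [p [vp hp]] Phi1 ov _]]] := resource_bell k20 res.
pose s : R := 2^-1 ^+ k.
have s0 : 0 < s by rewrite exprn_gt0 ?invr_gt0 ?ltr0n.
have s1 : s <= 1 by rewrite exprn_ile1 ?invr_ge0 ?ler0n // invf_le1 ?ltr0n // ler1n.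
exists i; rewrite /E_g lee_fin; set A := (X in sup X).
have ubA : forall r, A r -> r <= s.
  move=> _ [phi [/product_state_vec [pphi phi1] ->]].
  rewrite inner_conj sqmod_conj; set z := inner phi (psi i).
  (* Scaling the product state by its overlap [z] makes the inner product equal to $t = |z|^2$. The
     bound reads $2t \le s(t+1)$, hence $t \le s$ because $s \le 1$. *)
  have := @locc_overlap _ _ Phi s p (psi i) (ltW s0) Phi1 _ vp hp (scalev z phi)
    (product_vec_scale z q pphi).
  rewrite inner_scalel -/z -sqmodE norm2_scale phi1 (n1 i) mulr1 /=.
  have hz := sqmod_ge0 z => h.
  have {}h : 2 * sqmod z <= s * (sqmod z + 1).
    by apply: h => pi ppi; rewrite expr2 -exprD; exact: ov.
  nra.
have [x hx] := normalized_nz (n1 i).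
have Ax : A (sqmod (psi i x)).
  exists (ket R x); split; first exact: product_state_ket.
  by rewrite inner_ket sqmod_conj.
have supA : has_sup A by split; [exists (sqmod (psi i x)) | exists s => r; exact: ubA].
have sup0 : 0 < sup A.
  apply: (@lt_le_trans _ _ (sqmod (psi i x))); last exact: sup_upper_bound.
  by rewrite lt_neqAle eq_sym sqmod_eq0 hx sqmod_ge0.
have sups : sup A <= s by apply: ge_sup => //; exists (sqmod (psi i x)).
rewrite lerNr; apply: le_trans (ler_log2 sup0 sups) _.
by rewrite /log2 /s exprVn lnV ?posrE ?exprn_gt0 ?ltr0n // mulNr -/(log2 _) log2_exp2.
Qed.

End BellConsequences.

(** * Local unitaries acting on blocks *)

Section Unitaries.
Variable R : realType.
Local Notation C := (R[i]).

Lemma opmatT (J : finType) (u : locmat R J) x y : opmat [set: J] u x y = u x y.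
Proof.
have r z : restrB [set: J] z = z by apply/ffunP => q; rewrite ffunE inE.
by rewrite /opmat !r ifT //; apply/forallP => q; rewrite inE.
Qed.

Lemma applyopTE (J : finType) (u : locmat R J) v x :
  applyop [set: J] u v x = \sum_y u x y * v y.
Proof. by rewrite ffunE; apply: eq_bigr => y _; rewrite opmatT. Qed.

(* The reflection 1 - <w|a>^-1 |w><w| with w = a - b: it is unitary because
   <w|w> = 2 Re <w|a>, and for w = 0 the convention 0^-1 = 0 makes it 1. *)
Lemma householder (J : finType) (a b : qstate R J) :
  inner a a = 1 -> inner b b = 1 ->
  exists u : locmat R J,
    [/\ local_unitary [set: J] u, applyop [set: J] u a = b
      & forall c, inner a c = inner b c -> applyop [set: J] u c = c].
Proof.
move=> a1 b1; pose w := qadd a (qopp b); pose al := inner w a.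
have wr c : inner w c = inner a c - inner b c.
  by rewrite inner_addl inner_oppl.
have ww : inner w w = al + (al^*)%C.
  rewrite wr (inner_conj w a) (inner_conj w b) /al !wr !conjcB -!inner_conj a1 b1.
  by ring.
pose u : locmat R J := fun x y => (x == y)%:R - al^-1 * (w x * ((w y)^*)%C).
have uE v x : applyop [set: J] u v x = v x - al^-1 * inner w v * w x.
  rewrite applyopTE /u; under eq_bigr do rewrite mulrBl.
  rewrite sumrB (bigD1 x) //= eqxx mul1r big1 ?addr0; last first.
    by move=> y yx; rewrite eq_sym (negbTE yx) mul0r.
  congr (_ - _); rewrite /inner mulr_sumr mulr_suml; apply: eq_bigr => y _.
  by ring.
exists u; split.
- move=> x y; rewrite big_ord_recl big_ord0 addr0.
  under eq_bigr do rewrite !opmatT /u.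
  (* The entries of $u^\dagger u$ are expanded. The Kronecker symbols collapse the first three sums;
     the fourth contains $\langle w|w\rangle$, which cancels the two cross terms. *)
  transitivity (\sum_(z : basis J)
    ((z == x)%:R * (z == y)%:R - (z == x)%:R * (al^-1 * (w z * ((w y)^*)%C))
     - (z == y)%:R * ((al^*)%C^-1 * (((w z)^*)%C * w x))
     + al^-1 * (al^*)%C^-1 * (w x * ((w y)^*)%C) * (((w z)^*)%C * w z))).
    apply: eq_bigr => z _; rewrite conjcB !conjcM conjcK conjc_inv.
    rewrite -[((z == x)%:R^*)%C]/(conjc _) conjc_nat; ring.
  rewrite !big_split /= -mulr_sumr -/(inner w w) ww.
  rewrite (bigD1 x) //= eqxx mul1r big1 ?addr0; last first.
    by move=> z /negbTE ->; rewrite mul0r.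
  rewrite [X in _ + X + _ + _](bigD1 x) //= eqxx mul1r big1 ?addr0; last first.
    by move=> z /negbTE ->; rewrite mul0r oppr0.
  rewrite [X in _ + _ + X + _](bigD1 y) //= eqxx mul1r big1 ?addr0; last first.
    by move=> z /negbTE ->; rewrite mul0r oppr0.
  have [->|al0] := eqVneq al 0; first by rewrite conjc0 invr0; ring.
  have alc0 : (al^*)%C != 0 by rewrite conjc_eq0.
  by field; apply/andP.
- apply/ffunP => x; rewrite uE -/al.
  have [al0|al0] := eqVneq al 0; last by rewrite mulVf // mul1r !ffunE; ring.
  have w0 : w x = 0.
    by apply: norm2_eq0; rewrite norm2_Re ww al0 conjc0 addr0.
  rewrite w0 mulr0 subr0; move: w0; rewrite !ffunE => /eqP.
  by rewrite subr_eq0 => /eqP.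
- by move=> c ac; apply/ffunP => x; rewrite uE wr ac subrr mulr0 mul0r subr0.
Qed.

Section BlockUnitary.
Variables (I J : finType) (i0 : I) (U : locmat R J).
Hypothesis uU : local_unitary [set: J] U.

(** Written as a fibre of [fst], so that it is visibly a member of the block partition. *)
Let B : {set I * J} := fst @^-1: [set i0].
Let e (k : J) := (i0, k).

Let e_inj : injective e. Proof. by move=> k k' []. Qed.

Let BE : B =i codom e.
Proof.
move=> [i k]; rewrite !inE /=; apply/eqP/codomP => [->|[k' [-> _]] //].
by exists k.
Qed.

Definition block_op : locmat R (I * J)%type := fun x y => U (rowb x i0) (rowb y i0).

Lemma rowb_restrB x : rowb (restrB B x) i0 = rowb x i0.
Proof. by apply/ffunP => k; rewrite !ffunE !inE eqxx. Qed.

Lemma rowb_upd x s i : rowb (upd e x s) i = if i == i0 then s else rowb x i.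
Proof.
apply/ffunP => k; rewrite ffunE; case: eqP => [->|ii0].
  by rewrite -[(i0, k)]/(e k) upd_in.
rewrite upd_out ?ffunE // -BE !inE; exact/eqP.
Qed.

(** Only strings agreeing off the block are coupled. If [x] and [y] agree there, the relation is
    unitarity of [U] on row [i0]; otherwise both sides vanish. *)
Lemma block_op_unitary : local_unitary B block_op.
Proof.
move=> x y; rewrite big_ord_recl big_ord0 addr0.
transitivity (\sum_(z : basis (I * J)%type |
     [forall q, (q \notin B) ==> (x q == z q)])
   ((U (rowb z i0) (rowb x i0))^*)%C * opmat B block_op z y).
  rewrite [RHS]big_mkcond; apply: eq_bigr => z _.
  rewrite {1}/opmat /block_op !rowb_restrB.
  have -> : [forall q, (q \notin B) ==> (z q == x q)] =
            [forall q, (q \notin B) ==> (x q == z q)].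
    by apply: eq_forallb => q; rewrite eq_sym.
  by case: ifP => // _; rewrite conjc0 mul0r.
rewrite (sum_upd e_inj _ _ BE).
have ag s : [forall q, (q \notin B) ==> (upd e x s q == y q)] =
            [forall q, (q \notin B) ==> (x q == y q)].
  by apply: eq_forallb => q; rewrite BE; case: (boolP (q \in _)) => //= h; rewrite upd_out.
have [xy|nxy] := boolP [forall q, (q \notin B) ==> (x q == y q)]; last first.
  have -> : (x == y) = false.
    apply: contraNF nxy => /eqP ->; apply/forallP => q; exact/implyP.
  by rewrite big1 // => s _; rewrite /opmat ag (negbTE nxy) mulr0.
transitivity ((rowb x i0 == rowb y i0)%:R : C); last first.
  congr (nat_of_bool _)%:R; apply/eqP/eqP => [rxy|-> //].
  apply/ffunP => -[i k]; have [ii|ii] := eqVneq i i0.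
    by move/ffunP: rxy => /(_ k); rewrite !ffunE ii.
  by have /forallP/(_ (i, k)) := xy; rewrite !inE /= ii => /eqP.
have := uU (rowb x i0) (rowb y i0); rewrite big_ord_recl big_ord0 addr0 => <-.
apply: eq_bigr => s _; rewrite !opmatT {1}/opmat ag xy /block_op !rowb_restrB.
by rewrite !rowb_upd eqxx.
Qed.

Lemma block_op_encode (L : I -> bool -> qstate R J) phi :
  applyop B block_op (encode_blocks L phi) =
  encode_blocks (fun i b => if i == i0 then applyop [set: J] U (L i b) else L i b) phi.
Proof.
apply/ffunP => x; rewrite (applyop_upd e_inj _ _ _ BE) /block_op rowb_restrB.
under eq_bigr do rewrite rowb_upd eqxx ffunE mulr_sumr.
rewrite exchange_big ffunE; apply: eq_bigr => c _; rewrite ffunE (bigD1 i0) //= eqxx.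
rewrite applyopTE mulr_suml mulr_sumr; apply: eq_bigr => s _.
rewrite ffunE (bigD1 i0) //= rowb_upd eqxx mulrCA; congr (_ * _).
rewrite mulrA; congr (_ * _); apply: eq_bigr => i ii.
by rewrite rowb_upd (negbTE ii).
Qed.

End BlockUnitary.

(** * Partitions into parties *)

(** Here [f] sends a qubit to the party holding it: [id] when qubits are the parties, [fst] when
    blocks are. *)
Definition fibres (A I : finType) (f : A -> I) : {set {set A}} :=
  [set f @^-1: [set i] | i : I].

Lemma partition_fibres (A I : finType) (f : A -> I) :
  (forall i, exists a, f a = i) -> partition (fibres f) [set: A].
Proof.
move=> fs; apply/and3P; split.
- apply/eqP/setP => a; rewrite inE; apply/bigcupP.
  exists (f @^-1: [set f a]); last by rewrite !inE.
  exact: imset_f.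
- apply/trivIsetP => _ _ /imsetP [i _ ->] /imsetP [j _ ->] ij.
  rewrite -setI_eq0; apply/eqP/setP => a; rewrite !inE.
  by apply/negbTE; apply: contra ij => /andP [/eqP <- /eqP <-].
- apply/negP => /imsetP [i _ /setP]; have [a <-] := fs i.
  by move=> /(_ a); rewrite !inE eqxx.
Qed.

Lemma finest_fibres (Q : finType) : finest Q = fibres (@id Q).
Proof. by apply: eq_imset => q; apply/setP => q'; rewrite !inE. Qed.

Lemma partition_finest (Q : finType) : partition (finest Q) [set: Q].
Proof. by rewrite finest_fibres; apply: partition_fibres => q; exists q. Qed.

Lemma imset_finest (Q Q' : finType) (h : Q -> Q') : bijective h ->
  @imset _ _ (fun B : {set Q} => h @: B) (mem (finest Q)) = finest Q'.
Proof.
move=> [g hK gK]; rewrite /finest -imset_comp.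
apply/setP => A; apply/imsetP/imsetP => -[q _ ->] /=.
  by exists (h q); rewrite ?imset_set1.
by exists (g q); rewrite // imset_set1 gK.
Qed.

(** * Independence of the block measure from the logical states *)

Section Measure.
Variable E : emeasure R.
Hypothesis cE : measure_consistent E.
Variables (I J : finType) (phi : qstate R I).
Hypotheses (phi1 : normalized phi) (k0 : J).
Implicit Types L : I -> bool -> qstate R J.

Local Notation P := (fibres (@fst I J)).

Lemma blocks_partition : partition P [set: I * J].
Proof. by apply: partition_fibres => i; exists (i, k0). Qed.

Lemma measure_block_op L i0 (U : locmat R J) : orthonormal_pairs L ->
  local_unitary [set: J] U ->
  E P (encode_blocks
         (fun i b => if i == i0 then applyop [set: J] U (L i b) else L i b) phi) =
  E P (encode_blocks L phi).
Proof.
move=> oL uU; rewrite -block_op_encode; have [_ _ h] := cE.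
apply: h; [exact: blocks_partition | exact: imset_f | exact: block_op_unitary |].
by rewrite /normalized norm2_encode_blocks.
Qed.

(** One reflection carries [L i0 false] to [L' i0 false]. A second one carries the image of
    [L i0 true] to [L' i0 true] and fixes [L' i0 false], which is orthogonal to both of these
    vectors. *)
Lemma measure_change_block L L' i0 :
  orthonormal_pairs L -> orthonormal_pairs L' ->
  (forall i, i != i0 -> L i = L' i) ->
  E P (encode_blocks L phi) = E P (encode_blocks L' phi).
Proof.
move=> oL oL' LL'.
have [|| U [uU Uf _]] := @householder J (L i0 false) (L' i0 false); rewrite ?oL ?oL' //.
rewrite -(measure_block_op i0 oL uU); set L1 := (X in encode_blocks X _).
have iU a b : inner (applyop [set: J] U a) (applyop [set: J] U b) = inner a b.
  by rewrite -(kraus_inner a b uU) big_ord_recl big_ord0 addr0.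
have oL1 : orthonormal_pairs L1 by move=> i b b'; rewrite /L1; case: eqP => _; rewrite ?iU.
have L1f : L1 i0 false = L' i0 false by rewrite /L1 eqxx.
have [|| V [uV Vt Vfix]] := @householder J (L1 i0 true) (L' i0 true); rewrite ?oL1 ?oL' //.
rewrite -(measure_block_op i0 oL1 uV); congr (E P (encode_blocks _ phi)).
apply/funext => i; apply/funext => b; case: (eqVneq i i0) => [->|ii].
  by case: b => //; rewrite L1f Vfix // -{1}L1f oL1 oL'.
by rewrite /L1 (negbTE ii) LL'.
Qed.

Lemma measure_encode_indep L L' :
  orthonormal_pairs L -> orthonormal_pairs L' ->
  E P (encode_blocks L phi) = E P (encode_blocks L' phi).
Proof.
(* The blocks are converted one at a time: [mix s] already uses [L'] on the blocks listed in [s]. *)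
move=> oL oL'; pose mix (s : seq I) i := if i \in s then L' i else L i.
have omix s : orthonormal_pairs (mix s).
  by move=> i b b'; rewrite /mix; case: ifP.
have step s : E P (encode_blocks L phi) = E P (encode_blocks (mix s) phi).
  elim: s => [|i0 s ->] //; apply: (@measure_change_block _ _ i0) => // i ii.
  by rewrite /mix inE (negbTE ii).
rewrite (step (enum I)); congr (E P (encode_blocks _ phi)).
by apply/funext => i; rewrite /mix mem_enum.
Qed.

End Measure.

(** * The encoding that pads each qubit with ancillas *)

Section Ancillas.
Variable E : emeasure R.
Hypothesis cE : measure_consistent E.
Variables (I : finType) (m : nat) (phi : qstate R I).
Hypothesis phi1 : normalized phi.

(** The original qubit [i] takes position 0 of block [i], and its [m] ancillas take the positions
    after it. *)
Let h (p : (I + I * 'I_m)%type) : (I * 'I_m.+1)%type :=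
  match p with inl i => (i, ord0) | inr (i, k) => (i, lift ord0 k) end.

Let h' (p : (I * 'I_m.+1)%type) : (I + I * 'I_m)%type :=
  if unlift ord0 p.2 is Some k then inr (p.1, k) else inl p.1.

Let hK : cancel h h'.
Proof. by case=> [i|[i k]]; rewrite /h /h' /= ?unlift_none ?liftK. Qed.

Let h'K : cancel h' h.
Proof. by case=> [i k]; rewrite /h /h' /=; case: unliftP => [k' ->|->]. Qed.

Let h_bij : bijective h. Proof. by exists h'. Qed.

Let owner (p : (I + I * 'I_m)%type) : I := (h p).1.

Definition ancilla_ket (b : bool) : qstate R 'I_m.+1 :=
  ket R [ffun k => b && (k == ord0)].

Lemma ancilla_ket_ortho : orthonormal_pairs (fun _ : I => ancilla_ket).
Proof.
move=> _ b b'; rewrite inner_ket ffunE conjc_nat eq_sym; congr (nat_of_bool _)%:R.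
apply/eqP/eqP => [/ffunP/(_ ord0)|-> //]; by rewrite !ffunE eqxx !andbT => ->.
Qed.

(** Each logical ket is a single basis string, [c] padded with zeros. The sum over [c] thus keeps
    the one term [X] when all ancilla bits of [x] are 0, and no term otherwise. *)
Lemma encode_ancilla :
  encode_blocks (fun _ => ancilla_ket) phi = relabel h (append0 (I * 'I_m)%type phi).
Proof.
apply/ffunP => x; rewrite !ffunE.
pose X : basis I := [ffun i => x (i, ord0)].
have -> : [ffun q => [ffun q0 => x (h q0)] (inl q)] = X.
  by apply/ffunP => i; rewrite !ffunE.
have ketE c : logical_ket (fun _ => ancilla_ket) c x =
    \prod_i (rowb x i == [ffun k => c i && (k == ord0)])%:R.
  by rewrite ffunE; apply: eq_bigr => i _; rewrite ffunE.
case: ifP => [/forallP z|/negbT].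
  rewrite (bigD1 X) //= ketE big1 ?mulr1 => [|i _]; last first.
    rewrite (_ : _ == _) //; apply/eqP/ffunP => k; rewrite !ffunE.
    have [->|] := eqVneq k ord0; first by rewrite andbT.
    case: (unliftP ord0 k) => [k' -> _|-> //].
    by have := z (i, k'); rewrite ffunE /= => /negbTE ->; rewrite andbF.
  rewrite big1 ?addr0 // => c cX; rewrite ketE.
  have [i hi] : exists i, c i != X i.
    apply: contrapT => hn; move/eqP: cX; apply; apply/ffunP => i.
    by apply/eqP/negPn/negP => hi; apply: hn; exists i.
  rewrite (bigD1 i) //= (_ : _ == _ = false) ?mul0r ?mulr0 //.
  apply: contraNF hi => /eqP/ffunP/(_ ord0); rewrite !ffunE eqxx andbT => ->.
  exact: eqxx.
rewrite negb_forall => /existsP [[i k]]; rewrite negbK ffunE /= => xik.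
rewrite big1 // => c _; rewrite ketE (bigD1 i) //= (_ : _ == _ = false) ?mul0r ?mulr0 //.
by apply/negP => /eqP/ffunP/(_ (lift ord0 k)); rewrite !ffunE xik andbF.
Qed.

Lemma append0_normalized (Q Q0 : finType) (v : qstate R Q) :
  normalized v -> normalized (append0 Q0 v).
Proof.
have inl_inj : injective (@inl Q Q0) by move=> ? ? [].
have -> : append0 Q0 v = embed (@inl Q Q0) v.
  apply/ffunP => x; rewrite !ffunE; congr (if _ then _ else _).
  apply/forallP/forallP => z.
    case=> [q|q]; first by rewrite codom_f.
    by apply/implyP.
  move=> q; have /implyP := z (inr q); apply; apply/codomP => -[q' //].
by move=> v1; rewrite /normalized norm2_Re inner_embed // -norm2_Re.
Qed.

(** Invariance under adjoining ancillas, with ancilla [(i, k)] given to party [i], followed by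
    invariance under relabelling along [h]; the work lies in matching the partitions. *)
Lemma measure_ancilla :
  E (fibres (@fst I 'I_m.+1)) (encode_blocks (fun _ => ancilla_ket) phi) =
  Eq E phi.
Proof.
have [c1 c2 _] := cE.
rewrite /Eq -(c2 I (I * 'I_m)%type fst (finest I) phi (partition_finest I) phi1).
set P2 := imset _ _.
have P2E : P2 = fibres owner.
  rewrite /P2 /finest -imset_comp; apply: eq_imset => i /=.
  apply/setP => -[j|[j k]]; rewrite !inE.
    rewrite mem_imset; last by move=> ? ? [].
    rewrite inE (_ : inl j \in _ = false) ?orbF //.
    by apply/negbTE/imsetP => -[].
  rewrite [X in _ || X]mem_imset; last by move=> ? ? [].
  rewrite !inE (_ : inr _ \in _ = false) //.
  by apply/negbTE/imsetP => -[].
have partP2 : partition P2 [set: (I + I * 'I_m)%type].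
  by rewrite P2E; apply: partition_fibres => i; exists (inl i).
rewrite -(c1 _ _ h P2 _ h_bij partP2 (append0_normalized _ phi1)) encode_ancilla.
congr (E _ _); rewrite P2E /fibres -imset_comp; apply: eq_imset => i /=.
apply/setP => p; rewrite -[p in RHS]h'K -[p in LHS]h'K mem_imset ?inE //.
exact: can_inj hK.
Qed.

End Ancillas.

Lemma measure_encode (E : emeasure R) (I : finType) m (phi : qstate R I)
    (L : I -> bool -> qstate R 'I_m) :
  measure_consistent E -> normalized phi -> (0 < m)%N -> orthonormal_pairs L ->
  E _ (fibres (@fst I 'I_m)) (encode_blocks L phi) = Eq E phi.
Proof.
case: m L => // m L cE phi1 _ oL; rewrite -(measure_ancilla cE m phi1).
by apply: measure_encode_indep => //; [exact: ord0 | exact: ancilla_ket_ortho].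
Qed.

(** * Attaining the supremum *)

Lemma Efam_Estar (E : emeasure R) (Es : nat -> finType)
    (incl : forall i, Es i -> Es i.+1) (psi : forall i, qstate R (Es i)) :
  measure_consistent E -> typeII E -> coarsening_nonincreasing E ->
  (forall i, normalized (psi i)) -> encoded_universal_resource incl psi ->
  Efam (Eq E) psi = Estar (Eq E).
Proof.
move=> cE tII coarse n1 [m [zero [one [nb [emb [[z1 o1 io] emb_bij _ univ]]]]]].
apply/eqP; rewrite eq_le; apply/andP; split.
  apply: ge_ereal_sup => _ [i ->]; apply: ereal_sup_ubound.
  by exists (Es i), (psi i).
apply: ge_ereal_sup => _ [Q [phi [phi1 ->]]].
(* An arbitrary qubit set is first enumerated by an ordinal, which leaves the measure unchanged. *)
pose rk := @enum_rank Q.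
have rk_bij : bijective rk by exact: enum_rank_bij.
have [c1 _ _] := cE.
have := c1 _ _ rk (finest Q) phi rk_bij (partition_finest Q) phi1.
rewrite imset_finest // /Eq => <-; rewrite -/(Eq E _); set phi' := relabel rk phi.
have phi'1 : normalized phi'.
  by rewrite /normalized (norm2_relabel (@enum_rankK Q) (@enum_valK Q)).
have [i [b [b_inj hlocc]]] := univ _ phi' phi'1.
have m0 := orthogonal_inhabited z1 o1 io.
have oL := logical_pair_ortho (n := #|Q|) z1 o1 io.
have enc1 : normalized (encode zero one phi').
  by rewrite encodeE /normalized norm2_encode_blocks.
rewrite -(measure_encode cE phi'1 m0 oL) -encodeE.
(* From blocks back to single qubits by coarsening; type II monotonicity then compares the encoded
   state with [psi i]. *)
apply: le_trans (coarse _ _ _ (blocks_partition _ (Ordinal m0)) enc1) _.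
apply: (@le_trans _ _ (Eq E (psi i))); last by apply: ereal_sup_ubound; exists i.
apply: tII => //; exists (fun jk => emb i (b jk.1, jk.2)); split => //.
by move=> [j1 k1] [j2 k2] /(bij_inj (emb_bij i)) [/b_inj -> ->].
Qed.

End Unitaries.

Theorem theorem14 (R : realType) :
  (forall E : emeasure R,
     measure_consistent E -> typeI E -> typeII E -> coarsening_nonincreasing E ->
     forall (Es : nat -> finType) (incl : forall i, Es i -> Es i.+1)
            (psi : forall i, qstate R (Es i)),
       (forall i, injective (incl i)) -> (forall i, normalized (psi i)) ->
       encoded_universal_resource incl psi ->
       Efam (Eq E) psi = Estar (Eq E))
  /\
  (forall (Es : nat -> finType) (incl : forall i, Es i -> Es i.+1)
          (psi : forall i, qstate R (Es i)),
     (forall i, injective (incl i)) -> (forall i, normalized (psi i)) ->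
     encoded_universal_resource incl psi ->
     Efam (@E_s R) psi = +oo%E /\ Efam (@E_g R) psi = +oo%E).
Proof.
split=> [E cE _ tII coarse Es incl psi _ n1 res|Es incl psi _ n1 res].
  exact: Efam_Estar cE tII coarse n1 res.
by split; [exact: Efam_Es n1 res | exact: Efam_Eg n1 res].
Qed.
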